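(* Let $P$ be a path connected finite space. Then $\mathrm{TC}(P)=\mathrm{CC}(P)$.
   Context: A finite space is a finite $T_0$ topological space, identified with a finite poset: $x\le y$ iff $x$ lies in the smallest open set containing $y$; the open sets are exactly the down-sets (ideals), and continuous maps between finite spaces are exactly order-preserving maps. For $m\ge 0$, $J_m$ denotes the finite fence, the finite space on $\{0,1,\dots,m\}$ with zigzag order $0<1>2<3>\cdots m$. A combinatorial path of length $m$ in $P$ is a continuous map $J_m\to P$; $P^{J_m}$ is the finite space of such maps with the pointwise order, and $q_m:P^{J_m}\to P\times P$ is $q_m(\gamma)=(\gamma(0),\gamma(m))$. $\mathrm{CC}_m(P)$ is the smallest $n\ge 0$ such that there is an open cover $\{Q_i\}_{i=1}^n$ of $P\times P$ with a continuous section $s_i:Q_i\to P^{J_m}$ of $q_m$ for each $i$ ($\infty$ if none exists), and the combinatorial complexity is $\mathrm{CC}(P)=\min_{m\ge 0}\mathrm{CC}_m(P)$. The topological complexity $\mathrm{TC}(X)$ of a path connected space $X$ is the smallest $n\ge 0$ such that there is an open cover $\{U_i\}_{i=1}^n$ of $X\times X$ with a continuous section $U_i\to X^I$ of the path fibration $p:X^I\to X\times X$, $p(\gamma)=(\gamma(0),\gamma(1))$, for each $i$, where $X^I$ is the space of continuous paths $[0,1]\to X$ with the compact-open topology ($\infty$ if no such $n$ exists). *)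

(* Defs.v *)
From HB Require Import structures.
From mathcomp Require Import all_boot all_order all_algebra.
From mathcomp Require Import all_classical all_reals.
From mathcomp Require Import topology normedtype.

Set Implicit Arguments.
Unset Strict Implicit.
Unset Printing Implicit Defensive.

Import Order.TTheory GRing.Theory Num.Theory.
Import numFieldNormedType.Exports.

Local Open Scope classical_set_scope.

(* Extended naturals are [option nat], with [None] standing for infinity;
   [least S] is the least element of [S], infinite when [S] is empty. *)
Definition least (S : set nat) : option nat :=
  if `[< S !=set0 >]
  then Some (get [set n | S n /\ forall k, S k -> (n <= k)%N])
  else None.

Lemma least_SomeP (S : set nat) (n : nat) :
  least S = Some n <-> S n /\ forall k, S k -> (n <= k)%N.
Proof.
have uniq_min (a b : nat) : S a /\ (forall k, S k -> (a <= k)%N) ->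
    S b /\ (forall k, S k -> (b <= k)%N) -> a = b.
  by move=> [Sa la] [Sb lb]; apply/eqP; rewrite eqn_leq la // lb.
rewrite /least; case: asboolP => [[x Sx]|S0]; last first.
  by split=> // -[Sn _]; case: S0; exists n.
have exS : exists k, `[< S k >] by exists x; apply/asboolP.
have [m /asboolP Sm lem] := ex_minnP exS.
have minm : S m /\ forall k, S k -> (m <= k)%N.
  by split=> // k Sk; apply/lem/asboolP.
have minget := @getI _ [set n | S n /\ forall k, S k -> (n <= k)%N] m minm.
split=> [[<-]|minn]; first exact: minget.
by congr Some; exact: uniq_min minget minn.
Qed.

Lemma least_NoneP (S : set nat) : least S = None <-> S = set0.
Proof.
rewrite /least; case: asboolP => [[x Sx]|S0]; split=> //.
  by move=> SE; rewrite SE in Sx.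
by move=> _; rewrite -subset0 => x Sx; apply: S0; exists x.
Qed.

(* The least number of open sets covering the base over each of which the map
   [q] has a continuous section. *)
Definition sectional_number (E B : topologicalType) (q : E -> B) : option nat :=
  least [set n | exists Q : 'I_n -> set B,
    [/\ forall i, open (Q i),
        \bigcup_(i in [set: 'I_n]) Q i = [set: B] &
        forall i, exists s : set_type (Q i) -> E,
          continuous s /\ forall x, q (s x) = \val x]].

Section topological_complexity.
Variable R : realType.
Local Open Scope ring_scope.

Definition unit_interval : Type := set_type `[0 : R, 1]%classic.

HB.instance Definition _ := Topological.on unit_interval.

Lemma mem_I0 : (0 : R) \in `[0 : R, 1]%classic.
Proof. by rewrite inE /= in_itv /= lexx ler01. Qed.

Lemma mem_I1 : (1 : R) \in `[0 : R, 1]%classic.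
Proof. by rewrite inE /= in_itv /= lexx ler01. Qed.

Definition I0 : unit_interval := exist _ 0 mem_I0.
Definition I1 : unit_interval := exist _ 1 mem_I1.

Variable X : topologicalType.

Definition path_connected : Prop :=
  forall x y : X, exists g : continuousType unit_interval X,
    g I0 = x /\ g I1 = y.

(* Continuous paths, as a subspace of the compact-open function space. *)
Definition path_space : topologicalType :=
  initial_topology
    (fun g : continuousType unit_interval X =>
       (g : unit_interval -> X) : {compact-open, unit_interval -> X}).

Definition path_fibration (g : path_space) : X * X :=
  let g' : continuousType unit_interval X := g in (g' I0, g' I1).

Definition TC : option nat := sectional_number path_fibration.

End topological_complexity.

Definition downset_space (T : choiceType) (le : T -> T -> Prop) : Type := T.

Section downset_topology.
Variables (T : choiceType) (le : T -> T -> Prop).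

Definition downset : set_system (downset_space le) :=
  [set A | forall x y, le x y -> A y -> A x].

Lemma downsetT : downset setT.
Proof. by []. Qed.

Lemma downsetI : setI_closed downset.
Proof.
by move=> A B dA dB x y lexy [Ay By]; split; [exact: dA Ay|exact: dB By].
Qed.

Lemma downset_bigU (I : Type) (F : I -> set (downset_space le)) :
  (forall i, downset (F i)) -> downset (\bigcup_i F i).
Proof. by move=> dF x y lexy [i _ Fiy]; exists i => //; exact: dF Fiy. Qed.

HB.instance Definition _ := Choice.copy (downset_space le) T.
HB.instance Definition _ := isOpenTopological.Build (downset_space le)
  downsetT downsetI downset_bigU.

End downset_topology.

(* The bigcap is the smallest open set containing [y] when [X] is finite. *)
Definition spec_le (X : topologicalType) (x y : X) : Prop :=
  (\bigcap_(U in [set U : set X | open U /\ U y]) U) x.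

(* 0 < 1 > 2 < 3 > ... : the odd points lie above their neighbours. *)
Definition fence_le (m : nat) (i j : 'I_m.+1) : Prop :=
  i = j \/ odd j /\ (i = j.+1 :> nat \/ j = i.+1 :> nat).

Definition fence (m : nat) : topologicalType := downset_space (@fence_le m).

Section combinatorial_complexity.
Variable P : topologicalType.

Definition comb_path_le (m : nat) (g h : continuousType (fence m) P) : Prop :=
  forall i : fence m, spec_le (g i) (h i).

Definition comb_path_space (m : nat) : topologicalType :=
  downset_space (@comb_path_le m).

Definition comb_endpoints (m : nat) (g : comb_path_space m) : P * P :=
  let g' : continuousType (fence m) P := g in
  (g' (ord0 : 'I_m.+1), g' (ord_max : 'I_m.+1)).

Definition CC_at (m : nat) : option nat :=
  sectional_number (@comb_endpoints m).

Definition CC : option nat := least [set n | exists m, CC_at m = Some n].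

End combinatorial_complexity.

(* Main.v *)
From HB Require Import structures.
Require Import Defs.
From mathcomp Require Import all_boot all_order all_algebra.
From mathcomp Require Import all_classical all_reals.
From mathcomp Require Import topology normedtype.
From mathcomp Require Import lra zify.

Set Implicit Arguments.
Unset Strict Implicit.
Unset Printing Implicit Defensive.

Import Order.TTheory GRing.Theory Num.Theory.
Import numFieldNormedType.Exports.

Local Open Scope classical_set_scope.

(**
  Over a finite base Q, nearby times u of a homotopy H into a finite space
  satisfy H u <= H t pointwise, so by connectedness of [0, 1] the maps H 0 and
  H 1 are joined by a finite zigzag of continuous maps Q -> P: a section of the
  path fibration over Q becomes a section of some q_m.  A zigzag can be held
  constant at its end, so the finitely many sections of a cover share one m.
  Conversely, precomposition with a path from 0 to m in the fence J_m turns
  combinatorial paths into paths, continuously: if g <= g' and g' maps a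
  compact set into an open set, which is a down-set, then so does g.
*)

(** * Finite spaces and their specialization preorder *)

Lemma near_finite (I : choiceType) (T : Type) (F : set_system T)
    (R : I -> T -> Prop) :
  Filter F -> finite_set [set: I] ->
  (forall i, \forall t \near F, R i t) -> \forall t \near F, forall i, R i t.
Proof.
move=> FF /finite_fsetP[D ID] FR.
apply: filterS (@filter_bigI _ _ D R _ _ (fun i _ => FR i)) => t Rt i.
by apply: Rt; rewrite -ID.
Qed.

Lemma open_spec_le (X : topologicalType) (A : set X) (x y : X) :
  open A -> spec_le x y -> A y -> A x.
Proof. by move=> oA xy Ay; exact: xy. Qed.

Lemma spec_le_refl (X : topologicalType) (x : X) : spec_le x x.
Proof. by move=> U []. Qed.

(** Each of the finitely many [z] not below [x] is excluded by an open set containing [x];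
    intersecting these leaves a neighbourhood of points below [x]. *)
Lemma near_spec_le (X : topologicalType) (x : X) :
  finite_set [set: X] -> \forall y \near x, spec_le y x.
Proof.
move=> finX.
have : \forall y \near x, forall z, y = z -> spec_le z x.
  apply: near_finite => // z; have [zx|] := pselect (spec_le z x).
    exact: nearW.
  move=> /existsNP[U /not_implyP[[oU Ux] nUz]].
  apply: filterS (open_nbhs_nbhs (conj oU Ux)) => y Uy yz.
  by case: nUz; rewrite -yz.
by apply: filterS => y; exact.
Qed.

Lemma continuous_near_spec_le (X Y : topologicalType) (f : X -> Y) (x : X) :
  finite_set [set: Y] -> continuous f -> \forall y \near x, spec_le (f y) (f x).
Proof. by move=> finY cf; exact: cf (near_spec_le _ finY). Qed.

Lemma continuous_to_downset (X : topologicalType) (T : choiceType)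
    (le : T -> T -> Prop) (f : X -> downset_space le) :
  (forall x, \forall y \near x, le (f y) (f x)) -> continuous f.
Proof.
move=> fle; apply/continuousP => A dA; rewrite openE => x Ax.
by apply: filterS (fle x) => y fyx; exact: dA Ax.
Qed.

Lemma continuous_from_downset (X : topologicalType) (T : choiceType)
    (le : T -> T -> Prop) (f : downset_space le -> X) :
  (forall x y, le x y -> spec_le (f x) (f y)) -> continuous f.
Proof.
move=> fle; apply/continuousP => A oA.
have : downset (f @^-1` A).
  by move=> x y xy; exact: open_spec_le oA (fle _ _ xy).
exact.
Qed.

(** [segment_connected] concerns subsets of [R], so [A] and its complement are written as traces of
    open sets [B] and [C] of [R]. *)
Lemma unit_interval_clopen (R : realType) (A : set (unit_interval R)) :
  open A -> open (~` A) -> A !=set0 -> A = setT.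
Proof.
move=> [B oB BA] [C oC CA] [a Aa].
have BE t : B (\val t) <-> A t by rewrite -BA.
have CE t : C (\val t) <-> ~ A t by rewrite -[~ A t]/((~` A) t) -CA.
have IB : `[0%R : R, 1%R]%classic `&` B = `[0%R, 1%R]%classic.
  apply: segment_connected.
  - by exists (\val a); split; [exact: set_valP|apply/BE].
  - by exists B.
  - exists (~` C); first by rewrite closedC.
    have BC x : x \in `[0%R : R, 1%R]%classic -> B x <-> ~ C x.
      move=> xI; pose t : unit_interval R := exist _ x xI.
      have [BA1 BA2] := BE t; have [CA1 CA2] := CE t.
      split=> [/BA1 At /CA1|nC]; first exact.
      by apply: BA2; apply: contrapT => nA; exact: nC (CA2 nA).
    by apply/seteqP; split => x [xI xBC]; split=> //; apply/(BC x)/xBC/mem_set.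
apply/seteqP; split=> // t _; apply/BE.
have [] // : (`[0%R : R, 1%R]%classic `&` B) (\val t).
by rewrite IB; exact: set_valP.
Qed.

(** * Zigzags of continuous maps *)

Section zigzag.
Variables Q P : topologicalType.

(* Eventually constant rather than of length m, so that m can be increased
   freely. *)
Definition zigzag (m : nat) (h : nat -> Q -> P) : Prop :=
  [/\ forall j, continuous (h j),
      forall j q, if odd j then spec_le (h j.+1 q) (h j q)
                  else spec_le (h j q) (h j.+1 q) &
      forall j, (m <= j)%N -> h j = h m].

Lemma zigzag_cst (f : Q -> P) : continuous f -> zigzag 0 (fun=> f).
Proof.
by move=> cf; split=> // j q; case: ifP => _; exact: spec_le_refl.
Qed.

(** As [h] is constant from [m] on, the step to [g] can wait for an index of the right parity: even
    steps go up, odd steps go down. *)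
Lemma zigzag_extend (m : nat) (h : nat -> Q -> P) (g : Q -> P) :
  zigzag m h -> continuous g ->
  (forall q, spec_le (h m q) (g q)) \/ (forall q, spec_le (g q) (h m q)) ->
  exists m' h', [/\ zigzag m' h', h' 0 = h 0 & h' m' = g].
Proof.
move=> [ch hle hm] cg cmp.
have [M mM Mle] : exists2 M, (m <= M)%N &
    forall q, if odd M then spec_le (g q) (h m q) else spec_le (h m q) (g q).
  case: cmp => cmp; [exists m.*2|exists m.*2.+1]; try lia; move=> q.
  - by rewrite odd_double; exact: cmp.
  - by rewrite /= odd_double; exact: cmp.
(* M has the parity at which the fence steps in the direction from h m to g. *)
exists M.+1, (fun j => if (j <= M)%N then h j else g); split => //.
- split.
  + by move=> j; case: (j <= M)%N.
  + move=> j q; case: (ltngtP j M) => [jM|Mj|->].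
    * exact: hle.
    * by case: (odd j); exact: spec_le_refl.
    * by rewrite hm //; exact: Mle.
  + by move=> j Mj; rewrite ltnn leqNgt Mj.
- by rewrite ltnn.
Qed.

Lemma zigzag_homotopy (R : realType) (H : unit_interval R -> Q -> P) :
  finite_set [set: Q] -> finite_set [set: P] ->
  (forall t, continuous (H t)) -> (forall q, continuous (H^~ q)) ->
  exists m h, [/\ zigzag m h, h 0 = H (I0 R) & h m = H (I1 R)].
Proof.
move=> finQ finP cH cHt.
pose A t := exists m h, [/\ zigzag m h, h 0 = H (I0 R) & h m = H t].
have Hnear t : \forall u \near t, forall q, spec_le (H u q) (H t q).
  apply: (@near_finite _ _ (nbhs t) (fun q u => spec_le (H u q) (H t q)))
    => // q.
  exact: (@continuous_near_spec_le _ _ (H^~ q) t).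
suff: A (I1 R) by [].
suff -> : A = setT by [].
apply: unit_interval_clopen.
(* [A] is open: a zigzag ending at [H t] takes one more step, down to [H u]. *)
- rewrite openE => t [m [h [zh h0 hm]]]; apply: filterS (Hnear t) => u ut.
  have [|m' [h' [zh' h'0 h'm]]] := zigzag_extend zh (cH u).
    by right; rewrite hm.
  by exists m', h'; rewrite h'0.
(* [A] is closed: if a zigzag reached a nearby [H u], one step up would reach [H t]. *)
- rewrite openE => t nAt; apply: filterS (Hnear t) => u ut [m [h [zh h0 hm]]].
  apply: nAt; have [|m' [h' [zh' h'0 h'm]]] := zigzag_extend zh (cH t).
    by left; rewrite hm.
  by exists m', h'; rewrite h'0.
- exists (I0 R), 0%N, (fun=> H (I0 R)); split => //; exact: zigzag_cst.
Qed.

(** [M] may exceed [m], so that the sections over all sets of a cover can get one common length. *)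
Lemma zigzag_section (m M : nat) (h : nat -> Q -> P) :
  finite_set [set: P] -> zigzag m h -> (m <= M)%N ->
  exists s : Q -> comb_path_space P M,
    continuous s /\ forall q, comb_endpoints (s q) = (h 0 q, h m q).
Proof.
move=> finP [ch hle hm] mM.
have cq q : continuous ((fun i : 'I_M.+1 => h i q) : fence M -> P).
  apply: continuous_from_downset => i j [->|[oj ij]]; first exact: spec_le_refl.
  case: ij => ij.
    by have := hle j q; rewrite oj -ij.
  by have := hle i q; move: oj; rewrite ij /= => /negbTE ->.
pose g q : continuousType (fence M) P :=
  HB.pack ((fun i : 'I_M.+1 => h i q) : fence M -> P)
    (@isContinuous.Build (fence M) P _ (cq q)).
exists g; split; last first.
  by move=> q; rewrite /comb_endpoints /= -(hm M).
apply: continuous_to_downset => q.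
(* Paths are ordered pointwise, so the neighbourhoods found for the finitely many vertices are
   intersected. *)
apply: (@filter_forall _ 'I_M.+1 (fun i q' => spec_le (h i q') (h i q))) => i.
exact: continuous_near_spec_le.
Qed.

End zigzag.

(** * From combinatorial paths to paths *)

Section fence_path.
Variable R : realType.
Local Open Scope ring_scope.

(* The odd points of the fence are closed: an odd k has the single preimage k,
   an even k the preimage ]k - 1, k + 1[. *)
Definition zigzag_floor (x : R) : nat :=
  let k := Num.truncn x in if odd k && (x != k%:R) then k.+1 else k.

Lemma zigzag_floor_nat (m : nat) : zigzag_floor m%:R = m.
Proof. by rewrite /zigzag_floor natrK eqxx andbF. Qed.

(** Rounding up from k to k + 1 occurs only when x > k, which forces k < m. *)
Lemma zigzag_floor_le (x : R) (m : nat) :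
  0 <= x <= m%:R -> (zigzag_floor x <= m)%N.
Proof.
move=> /andP[x0 xm]; rewrite /zigzag_floor.
have /andP[kx xk] := truncn_itv x0; set k := Num.truncn x in kx xk *.
have km : (k <= m)%N by rewrite -(ler_nat R); exact: le_trans xm.
case: ifP => // /andP[_ xNk].
rewrite ltn_neqAle km andbT; apply: contra_neqN xNk => /eqP kE.
by apply/eqP; rewrite eq_le kx kE xm.
Qed.

(** The local condition of [continuous_to_downset] for the fence order, stated on natural numbers so
    that no length [m] enters. *)
Lemma zigzag_floor_near (x : R) : 0 <= x -> \forall y \near x, 0 <= y ->
  zigzag_floor y = zigzag_floor x \/ odd (zigzag_floor x) /\
    (zigzag_floor y = (zigzag_floor x).+1 \/
     zigzag_floor x = (zigzag_floor y).+1).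
Proof.
move=> x0; rewrite /zigzag_floor.
have /andP[kx xk] := truncn_itv x0; set k := Num.truncn x in kx xk *.
rewrite -natr1 in xk.
have kx' : \forall y \near x, x != k%:R -> k%:R < y.
  have [xE|/eqP xN] := pselect (x = k%:R).
    by apply: (@filterE _ (nbhs x)) => y /eqP.
  by apply: filterS (lt_nbhsr (_ : k%:R < x)) => //; rewrite lt_def xN.
near=> y => y0.
have ky : k%:R - 1 < y by near: y; apply: lt_nbhsr; lra.
have yk : y < k%:R + 1 by near: y; exact: lt_nbhsl.
have xNk : x != k%:R -> k%:R < y by near: y.
have /andP[jy yj] := truncn_itv y0; set j := Num.truncn y in jy yj *.
rewrite -natr1 in yj.
have kj : (k <= j.+1)%N by rewrite -ltnS -(ltr_nat R) -!natr1; lra.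
have jk : (j <= k)%N by rewrite -ltnS -(ltr_nat R) -natr1; lra.
(* Near an integer k, [y] truncates to k or k - 1; otherwise [y] stays in ]k, k + 1[ and is rounded
   as [x] is. *)
have [xE|xN] := eqVneq x k%:R.
  have jE : y = j%:R -> (k <= j)%N.
    by move=> yE; rewrite -ltnS -(ltr_nat R) -natr1; lra.
  rewrite /= andbF; have [/jE|_] := eqVneq y j%:R; rewrite /= ?andbT ?andbF.
    by move: jk; clearbody j k; clear; lia.
  by case: ifP; move: kj jk; clearbody j k; clear; lia.
have {}kj : (k <= j)%N.
  by rewrite -ltnS -(ltr_nat R) -natr1; have := xNk xN; lra.
have -> : j = k by apply/eqP; rewrite eqn_leq jk.
by left; rewrite (gt_eqF (xNk xN)).
Unshelve. all: by end_near.
Qed.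

(** Time is stretched to [0, m], so that its ends go to 0 and [m]. By [zigzag_floor_le] the default
    value of [inord] never occurs. *)
Definition fence_path_fun (m : nat) (t : unit_interval R) : fence m :=
  inord (zigzag_floor (\val t * m%:R)).

Lemma val_fence_path_fun (m : nat) (t : unit_interval R) :
  fence_path_fun m t = zigzag_floor (\val t * m%:R) :> nat.
Proof.
rewrite inordK // ltnS; apply: zigzag_floor_le.
have := valP t; rewrite inE /= in_itv /= => /andP[t0 t1].
by rewrite mulr_ge0 //= ler_piMl.
Qed.

Lemma fence_path_fun_continuous (m : nat) : continuous (fence_path_fun m).
Proof.
apply: continuous_to_downset => t.
have ge0 (u : unit_interval R) : 0 <= \val u * m%:R.
  by have := valP u; rewrite inE /= in_itv /= => /andP[u0 u1]; rewrite mulr_ge0.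
have cm : {for t, continuous (fun u : unit_interval R => \val u * m%:R : R)}.
  apply: (@continuous_comp _ _ _ (fun u : unit_interval R => \val u : R)
    ( *%R^~ m%:R)).
    exact: initial_continuous.
  exact: mulrr_continuous.
have := cm _ (zigzag_floor_near (ge0 t)).
apply: (@filterS _ (nbhs t)) => u /= /(_ (ge0 u)).
rewrite -!val_fence_path_fun => -[/val_inj ->|[ot ut]]; first by left.
by right; split.
Qed.

Lemma fence_path_fun0 (m : nat) : fence_path_fun m (I0 R) = ord0.
Proof.
by apply/val_inj; rewrite /= val_fence_path_fun mul0r -(zigzag_floor_nat 0).
Qed.

Lemma fence_path_fun1 (m : nat) : fence_path_fun m (I1 R) = ord_max.
Proof.
by apply/val_inj; rewrite /= val_fence_path_fun mul1r zigzag_floor_nat.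
Qed.

Definition fence_path (m : nat) : continuousType (unit_interval R) (fence m) :=
  HB.pack (fence_path_fun m)
    (@isContinuous.Build _ _ _ (@fence_path_fun_continuous m)).

Variable P : topologicalType.

Definition realize (m : nat) (g : comb_path_space P m) : path_space R P :=
  let g' : continuousType (fence m) P := g in
  (g' \o fence_path m : continuousType (unit_interval R) P).

Lemma realize_endpoints (m : nat) (g : comb_path_space P m) :
  path_fibration (realize g) = comb_endpoints g.
Proof.
by rewrite /path_fibration /comb_endpoints /= fence_path_fun0 fence_path_fun1.
Qed.

Lemma realize_continuous (m : nat) : continuous (@realize m).
Proof.
pose F (g : comb_path_space P m) : {compact-open, unit_interval R -> P} :=
  (realize g : continuousType (unit_interval R) P).
suff cF : continuous F.
  by apply/continuousP => _ [B oB <-]; move/continuousP: cF => /(_ B oB).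
move=> g.
have FF : Filter (F x @[x --> g]) by exact: fmap_filter (nbhs_filter g).
apply/(compact_open_cvgP _ FF) => K O _ oO gKO.
apply: open_nbhs_nbhs; split=> //.
have : downset (F @^-1` [set h | h @` K `<=` O] : set (comb_path_space P m)).
  move=> h h' hh' h'KO _ [t Kt <-].
  by apply: open_spec_le oO (hh' _) (h'KO _ _); exists t.
exact.
Qed.

(** A point is compact, so asking the value at [t] to lie in an open set is an open condition in the
    compact-open topology. *)
Lemma path_eval_continuous (t : unit_interval R) :
  continuous (fun g : path_space R P =>
    (g : continuousType (unit_interval R) P) t).
Proof.
apply/continuousP => O oO.
exists [set h : {compact-open, unit_interval R -> P} | h @` [set t] `<=` O].
  exact: compact_open_open (@compact_set1 _ t) oO.
apply/seteqP; split=> g /=; first by apply; exists t.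
by move=> gO _ [_ -> <-].
Qed.

End fence_path.

(** * Equality of the two invariants *)

(** Merges the minimum over [m] in [CC] into one least element, so that both invariants become
    [least] of a set of cover sizes. *)
Lemma least_bigcup (S : nat -> set nat) :
  least [set n | exists m, least (S m) = Some n] = least (\bigcup_m S m).
Proof.
set T := [set n | _].
have TS : T `<=` \bigcup_m S m.
  by move=> n [m /least_SomeP[Smn _]]; exists m.
have ST n : (\bigcup_m S m) n -> exists2 k, T k & (k <= n)%N.
  move=> [m _ Smn]; case E : (least (S m)) => [k|].
    by exists k; [exists m|have [_] := (least_SomeP _ _).1 E; exact].
  by have := (least_NoneP _).1 E; move=> S0; rewrite S0 in Smn.
case E : (least (\bigcup_m S m)) => [n|].
  have [/ST[k Tk kn] nmin] := (least_SomeP _ _).1 E.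
  have kE : k = n by apply/eqP; rewrite eqn_leq kn nmin //; exact: TS.
  by apply/least_SomeP; split=> [|j /TS /nmin //]; rewrite -kE.
apply/least_NoneP; rewrite -subset0 => n /TS.
by rewrite ((least_NoneP _).1 E).
Qed.

Lemma finite_set_type (T : choiceType) (A : set T) :
  finite_set [set: T] -> finite_set [set: set_type A].
Proof.
move=> finT; rewrite -(preimage_setT (\val : set_type A -> T)).
by apply: finite_preimage => // x y _ _ /val_inj.
Qed.

(** Read as a function of time, the section is a homotopy over [Q] from the first projection to the
    second, to which [zigzag_homotopy] applies. *)
Lemma path_section_zigzag (R : realType) (P : topologicalType)
    (Q : set (P * P)) (s : set_type Q -> path_space R P) :
  finite_set [set: P] -> continuous s ->
  (forall x, path_fibration (s x) = \val x) ->
  exists m h, zigzag m h /\ forall x : set_type Q, (h 0 x, h m x) = \val x.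
Proof.
move=> finP cs sE.
pose H t (x : set_type Q) := (s x : continuousType (unit_interval R) P) t.
have finQ : finite_set [set: set_type Q].
  by apply: finite_set_type; rewrite -setXTT; exact: finite_setX.
have [t x||m [h [zh h0 hm]]] := @zigzag_homotopy _ _ R H finQ finP.
- exact: continuous_comp (cs x) (@path_eval_continuous R P t _).
- by move=> x; exact: cts_fun.
- by exists m, h; split=> // x; rewrite h0 hm -sE.
Qed.

Theorem theorem3p6 (R : realType) (P : topologicalType)
    (finP : finite_set [set: P]) (T0P : kolmogorov_space P)
    (pcP : path_connected R P) :
  TC R P = CC P.
Proof.
rewrite /CC /CC_at /sectional_number least_bigcup /TC /sectional_number.
congr least; apply/seteqP; split=> n.
  move=> [Q [oQ covQ sQ]].
  have /choice[m mP] i : exists m, exists h, zigzag m h /\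
      forall x : set_type (Q i), (h 0 x, h m x) = \val x.
    by have [s [cs sE]] := sQ i; exact: path_section_zigzag cs sE.
  (* The longest zigzag sets the common length; the others stay constant at their ends. *)
  exists (\max_i m i) => //; exists Q; split=> // i.
  have [h [zh hE]] := mP i.
  have [s [cs sE]] := zigzag_section finP zh (leq_bigmax i).
  by exists s; split=> // x; rewrite sE hE.
move=> [m _ [Q [oQ covQ sQ]]]; exists Q; split=> // i.
have [s [cs sE]] := sQ i; exists (fun x => realize R (s x)); split.
  by move=> x; exact: continuous_comp (cs x) (@realize_continuous R P m _).
by move=> x; rewrite realize_endpoints sE.
Qed.
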